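(* Let $p,q,c$ be integers with $q \geq p \geq 1$ and $c \geq p+q$. There is a function $\varepsilon(n)=o(n^2)$ (depending on $p,q,c$) such that for every positive integer $n$, every collection of directed graphs $G_1, \ldots, G_c$ on a common set of $n$ vertices containing no rainbow $S_{p,q}$ satisfies \[\sum_{i=1}^c e(G_i) \leq \begin{cases} (p+q-1)n^2 + \varepsilon(n) & \text{if } c \leq p+2q-1+2\sqrt{pq},\\[2pt] \left(\frac{(c-p+1)^2}{4(c-q+1)} + p-1\right)n^2 + \varepsilon(n) & \text{if } c \geq p+2q-1+2\sqrt{pq}. \end{cases} \] Moreover, these bounds are tight up to a lower order error term: for every $n$ there is a collection on $n$ vertices with no rainbow $S_{p,q}$ whose sum of edge numbers is at least the corresponding main term minus $o(n^2)$.
   Context: Each $G_i$ is a directed graph without loops or multiple edges on the common vertex set $V$ (for distinct $u,v$, the edges $uv$ and $vu$ may both be present); $e(G_i)$ denotes the number of directed edges of $G_i$. Think of $G_i$ as the edges of color $i$. For integers $p,q\ge 0$, $S_{p,q}$ denotes the orientation of a star on $p+q+1$ vertices whose center has indegree $p$ and outdegree $q$. The collection $(G_1,\ldots,G_c)$ contains a rainbow copy of a directed graph $F$ if there exist an injective map $f: V(F)\to V$ and an injective map $\varphi: E(F)\to\{1,\ldots,c\}$ such that for every edge $xy\in E(F)$, the edge $f(x)f(y)$ belongs to $G_{\varphi(xy)}$. *)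

(* Defs.v *)
From mathcomp Require Import all_boot all_order all_algebra.
From mathcomp Require Import all_classical all_reals all_analysis.
Set Implicit Arguments.
Unset Strict Implicit.
Unset Printing Implicit Defensive.
Import Order.TTheory GRing.Theory Num.Theory.

Record digraph (V : finType) := Digraph {
  arc :> rel V;
  arc_irreflexive : irreflexive arc
}.

Definition arcs (V : finType) (G : digraph V) : {set V * V} :=
  [set uv | G uv.1 uv.2]%SET.

(* The centre is None, the p in-neighbours are the Some (inl i), and the
   q out-neighbours are the Some (inr j). *)
Definition star_rel (p q : nat) : rel (option ('I_p + 'I_q)) :=
  fun x y => match x, y with
             | Some (inl _), None => true
             | None, Some (inr _) => true
             | _, _ => false
             end.

Lemma star_rel_irreflexive (p q : nat) : irreflexive (@star_rel p q).
Proof. by case=> [[]|]. Qed.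

Definition star (p q : nat) : digraph (option ('I_p + 'I_q)) :=
  Digraph (@star_rel_irreflexive p q).

Definition contains_rainbow (W V : finType) (c : nat)
    (F : digraph W) (G : 'I_c -> digraph V) : Prop :=
  exists (f : W -> V) (phi : {xy : W * W | xy \in arcs F} -> 'I_c),
    [/\ injective f, injective phi
      & forall e : {xy : W * W | xy \in arcs F},
          G (phi e) (f (sval e).1) (f (sval e).2)].

Definition total_arcs (V : finType) (c : nat) (G : 'I_c -> digraph V) : nat :=
  \sum_(i < c) #|arcs (G i)|.

Local Open Scope ring_scope.

Definition threshold (R : realType) (p q : nat) : R :=
  p%:R + 2 * q%:R - 1 + 2 * Num.sqrt (p%:R * q%:R).

Definition low_density (R : realType) (p q : nat) : R := p%:R + q%:R - 1.

Definition high_density (R : realType) (p q c : nat) : R :=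
  (c%:R - p%:R + 1) ^+ 2 / (4 * (c%:R - q%:R + 1)) + p%:R - 1.

(* Main.v *)
(* Call a colour in-rich (out-rich) at v if at least p + q arcs of that colour
   enter (leave) v; arcs whose colour is poor at the relevant end number O(n).
   Leaves can be chosen greedily along rich colours, so without a rainbow star
   every vertex has fewer than p in-rich colours, or fewer than q out-rich ones,
   or fewer than p + q rich ones altogether. If X, Y, Z vertices are of these
   three types, counting the remaining arcs by the types of their two ends
   bounds their number, with d = c - q + 1, by
     d X Y - (q X + p Y) n + (p + q - 1) n^2,
   which is convex along rays from (X, Y) = (0, 0), hence largest for
   X = Y = 0 or for X + Y = n; the threshold decides between the two.
   Both cases are attained: by p + q - 1 complete colours, and by splitting the
   vertices into X with all colours leaving and p - 1 entering, and Y with all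
   colours entering and q - 1 leaving, where Y is about
   (c - p + 1) n / (2 (c - q + 1)). *)

Require Import Defs.
From mathcomp Require Import all_boot all_order all_algebra.
From mathcomp Require Import all_classical all_reals all_analysis.
From mathcomp Require Import ring lra zify.
From mathcomp Require Import fintype finset.
Set Implicit Arguments.
Unset Strict Implicit.
Unset Printing Implicit Defensive.
Import Order.TTheory GRing.Theory Num.Theory.
Import numFieldNormedType.Exports.

Local Open Scope nat_scope.
Local Open Scope set_scope.

(** * Greedy choice of distinct elements *)

Lemma distinct_representatives (I V : finType) (S : I -> {set V}) (v0 : V) :
  (forall i, #|I| <= #|S i|) ->
  exists2 f : I -> V, injective f & forall i, f i \in S i.
Proof.
move=> hS.
(* Induction on lists of indices, with injectivity required only on the list; [v0] supplies the
   function for the empty list. *)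
suff /(_ (enum I) (enum_uniq _)) [i|f finj fS] : forall s : seq I, uniq s ->
    (forall i, size s <= #|S i|) ->
    exists2 f : I -> V, {in s &, injective f} & {in s, forall i, f i \in S i}.
- by rewrite -cardE.
- by exists f => [i j|i]; [apply: finj|apply: fS]; rewrite mem_enum.
elim=> [_ _|i s IHs /= /andP[is_ us] hs]; first by exists (fun=> v0).
have [f finj fS] := IHs us (fun j => ltnW (hs j)).
(* The earlier indices use at most [size s] values, fewer than [S i] has, so a fresh [v] remains. *)
have /subsetPn [v vS vf] : ~~ (S i \subset [set f j | j in s]).
  apply/negP => /subset_leq_card le.
  have := leq_trans (hs i) (leq_trans le (leq_imset_card f [in s])).
  by rewrite ltnNge card_size.
have fne j : j \in s -> f j != v.
  by move=> js; apply: contraNneq vf => <-; apply: imset_f.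
exists (fun j => if j == i then v else f j) => [j k|j]; rewrite !inE.
  case: eqP => [->|_] /=; case: eqP => [->|_] //= js ks; first 2 last.
  - by apply: finj.
  - by move=> e; move/eqP: (fne _ ks); rewrite e.
  - by move=> e; move/eqP: (fne _ js); rewrite e.
by case: eqP => [->|_] //= js; apply: fS.
Qed.

Lemma set_between (T : finType) (A D : {set T}) (k : nat) :
  D \subset A -> #|D| <= k <= #|A| ->
  exists P : {set T}, [/\ D \subset P, P \subset A & #|P| = k].
Proof.
move=> DA /andP[Dk kA].
have : k - #|D| <= #|A :\: D| by rewrite cardsDS// leq_sub2r.
move=> /card_geqP[s [us ss sA]]; exists (D :|: [set x in s]); split.
- exact: subsetUl.
- rewrite subUset DA; apply/subsetP => x; rewrite inE => /sA.
  by rewrite inE => /andP[].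
- have -> : #|D :|: [set x in s]| = #|D| + #|[set x in s]|.
    rewrite -cardsUI; have -> : D :&: [set x in s] = set0.
      apply/setP => x; rewrite !inE; apply/negP => /andP[xD /sA].
      by rewrite inE xD.
    by rewrite cards0 addn0.
  by rewrite cardsE (card_uniqP us) ss subnKC.
Qed.

(** This is Hall's condition for [p] copies of [A] and [q] copies of [B]. The [p] elements of [A]
    are taken outside [B] as far as possible, which leaves enough of [B]. *)
Lemma disjoint_choice (T : finType) (A B : {set T}) (p q : nat) :
  p <= #|A| -> q <= #|B| -> p + q <= #|A :|: B| ->
  exists2 h : 'I_p + 'I_q -> T, injective h &
    forall s, h s \in (if s is inl _ then A else B).
Proof.
move=> pA qB pqAB.
have [P [PA cP qBP]] : exists P : {set T},
    [/\ P \subset A, #|P| = p & q <= #|B :\: P|].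
  have [le|/ltnW le] := leqP p #|A :\: B|.
    have [|P [_ PAB cP]] := @set_between _ (A :\: B) set0 p (sub0set _).
      by rewrite cards0.
    exists P; split=> //; first exact: subset_trans PAB (subsetDl _ _).
    rewrite (_ : B :\: P = B)//; apply/setDidPl.
    rewrite disjoint_sym; apply: disjointWl PAB _; rewrite disjoints_subset.
    by apply/subsetP => x; rewrite !inE => /andP[].
  (* Here [P] swallows all of [A :\: B], so [B :\: P] is [(A :|: B) :\: P], of size at least
     [p + q - p]. *)
  have [|P [ABP PA cP]] := @set_between _ A (A :\: B) p (subsetDl _ _).
    by rewrite le.
  exists P; split=> //.
  have -> : B :\: P = (A :|: B) :\: P.
    apply/setP => x; rewrite !inE; have [xP//=|xP /=] := boolP (x \in P).
    have [xA|//] := boolP (x \in A); apply: contraNT xP => xB.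
    by apply: (subsetP ABP); rewrite inE xA xB.
  rewrite cardsDS; last by apply: subset_trans PA (subsetUl _ _).
  by rewrite cP leq_subRL// (leq_trans (leq_addr q p)).
pose hl (a : 'I_p) : T := enum_val (cast_ord (esym cP) a).
pose hr (b : 'I_q) : T := enum_val (widen_ord qBP b).
have hlP a : hl a \in P by apply: enum_valP.
have hrP b : hr b \in B :\: P by apply: enum_valP.
exists (fun s => match s with inl a => hl a | inr b => hr b end).
  move=> [a|b] [a'|b'] e.
  - by move/enum_val_inj/cast_ord_inj: e => ->.
  - by have := hrP b'; rewrite inE -e hlP.
  - by have := hrP b; rewrite inE e hlP.
  - by move: e => /enum_val_inj/(congr1 (@nat_of_ord _))/= /ord_inj ->.
move=> [a|b]; first exact: (subsetP PA).
by have := hrP b; rewrite inE => /andP[].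
Qed.

(** * Rich colours and the upper count *)

Section Degrees.
Variables (V : finType) (c : nat) (G : 'I_c -> digraph V).

Definition inbrs (i : 'I_c) (v : V) : {set V} := [set u | G i u v].
Definition outbrs (i : 'I_c) (v : V) : {set V} := [set w | G i v w].
Definition in_rich (k : nat) (v : V) : {set 'I_c} :=
  [set i | k <= #|inbrs i v|].
Definition out_rich (k : nat) (v : V) : {set 'I_c} :=
  [set i | k <= #|outbrs i v|].

(** Distinct colours are chosen first, then distinct leaves: each chosen colour offers at least
    [p + q] neighbours, as many as there are leaves. *)
Lemma rainbow_star (p q : nat) (v : V) : 0 < p ->
  p <= #|in_rich (p + q) v| -> q <= #|out_rich (p + q) v| ->
  p + q <= #|in_rich (p + q) v :|: out_rich (p + q) v| ->
  contains_rainbow (star p q) G.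
Proof.
move=> p_gt0 pA qB pqAB.
have [h hinj hAB] := disjoint_choice pA qB pqAB.
pose S s := if s is inl _ then inbrs (h s) v else outbrs (h s) v.
have [s|f finj fS] := @distinct_representatives _ _ S v.
  rewrite card_sum !card_ord.
  by case: s (hAB s) => [a|b]; rewrite inE.
(* An arc of the star is determined by its leaf. The default is reached only at [(None, None)],
   which is not an arc. *)
pose leaf (e : option ('I_p + 'I_q) * option ('I_p + 'I_q)) :=
  match e with
  | (Some s, _) => s | (None, Some s) => s | _ => inl (Ordinal p_gt0)
  end.
exists (fun x => if x is Some s then f s else v), (fun e => h (leaf (sval e))).
have nv s : f s <> v.
  by move=> e; case: s e (fS s) => [a|b] e; rewrite inE e arc_irreflexive.
split.
- by move=> [s|] [t|] // => [/finj->//|/nv|/esym/nv].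
- move=> [[x y] e] [[x' y'] e'] /= /hinj le; apply: val_inj => /=.
  move: e e' le; rewrite !inE /=.
  case: x y => [[?|?]|] [[?|?]|]//= _;
    by case: x' y' => [[?|?]|] [[?|?]|]//= _ ->.
- move=> [[x y] e] /=; move: e; rewrite inE.
  case: x y => [[a|b]|] [[a'|b']|]//= _.
  + by have := fS (inl a); rewrite inE.
  + by have := fS (inr b'); rewrite inE.
Qed.

Lemma total_arcs_sum :
  total_arcs G = \sum_(u : V) \sum_(v : V) \sum_(i < c) G i u v.
Proof.
rewrite /total_arcs pair_bigA /= exchange_big /=; apply: eq_bigr => i _.
rewrite /arcs cardsE -sum1_card big_mkcond; apply: eq_bigr => -[u v] _.
by rewrite unfold_in /=; case: (G i u v).
Qed.

(** An arc not counted in the double sum has a colour poor at its tail or at its head. Each of these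
    two kinds contributes at most [k] arcs per vertex and colour. *)
Lemma total_arcs_rich (k : nat) :
  total_arcs G <=
    \sum_(u : V) \sum_(v : V) #|out_rich k u :&: in_rich k v| +
    2 * c * k * #|V|.
Proof.
rewrite total_arcs_sum.
have pointwise u v : \sum_(i < c) G i u v <=
    #|out_rich k u :&: in_rich k v| +
    \sum_(i < c) (i \notin out_rich k u) * G i u v +
    \sum_(i < c) (i \notin in_rich k v) * G i u v.
  rewrite -sum1_card [X in _ <= X + _ + _]big_mkcond -!big_split /=.
  apply: leq_sum => i _; rewrite [i \in _ :&: _]inE.
  by do 2 case: (_ \in _); case: (G i u v).
have poor (r : 'I_c -> V -> {set V}) v :
    \sum_(i < c) (~~ (k <= #|r i v|)) * #|r i v| <= c * k.
  rewrite -[X in X * k]card_ord -sum_nat_const; apply: leq_sum => i _.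
  by case: (leqP k #|r i v|) => //= /ltnW; rewrite mul1n.
have sum_poor (r : 'I_c -> V -> {set V}) :
    \sum_(v : V) \sum_(i < c) (~~ (k <= #|r i v|)) * #|r i v| <= c * k * #|V|.
  by rewrite mulnC -sum_nat_const; apply: leq_sum => v _; apply: poor.
apply: leq_trans (_ : _ <= \sum_(u : V) \sum_(v : V) (_ + _ + _)) _.
  by apply: leq_sum => u _; apply: leq_sum => v _; apply: pointwise.
under eq_bigr do rewrite !big_split /=.
rewrite !big_split /= -addnA leq_add2l -!mulnA mul2n -addnn !mulnA leq_add//.
  apply: leq_trans (sum_poor outbrs); apply: leq_sum => u _.
  rewrite exchange_big /=. apply: leq_sum => i _.
  rewrite -big_distrr /= inE leq_mul2l; apply/orP; right.
  rewrite -sum1_card [X in _ <= X]big_mkcond /=.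
  by apply: leq_sum => v _; rewrite inE; case: (G i u v).
rewrite exchange_big /=.
apply: leq_trans (sum_poor inbrs); apply: leq_sum => v _.
rewrite exchange_big /=; apply: leq_sum => i _.
rewrite -big_distrr /= inE leq_mul2l; apply/orP; right.
rewrite -sum1_card [X in _ <= X]big_mkcond /=.
by apply: leq_sum => u _; rewrite inE; case: (G i u v).
Qed.

Lemma total_arcs_types (p q : nat) : 0 < p -> p <= q ->
  ~ contains_rainbow (star p q) G ->
  exists X Y Z : nat, X + Y + Z = #|V| /\
    total_arcs G <=
      p.-1 * X * #|V| + c * (X * Y) + q.-1 * Y * (Y + Z) +
      (p + q).-1 * Z * #|V| + 2 * c * (p + q) * #|V|.
Proof.
move=> p_gt0 pq noR.
have q_gt0 := leq_trans p_gt0 pq.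
pose A := in_rich (p + q); pose B := out_rich (p + q).
pose x v : nat := #|A v| < p.
pose y v : nat := (p <= #|A v|) && (#|B v| < q).
pose z v : nat := (p <= #|A v|) && (q <= #|B v|).
have type v : [\/ [/\ x v = 1, y v = 0, z v = 0 & #|A v| <= p.-1],
    [/\ x v = 0, y v = 1, z v = 0 & #|B v| <= q.-1] |
    [/\ x v = 0, y v = 0, z v = 1 & #|A v :|: B v| <= (p + q).-1]].
  rewrite /x /y /z; have [Ap|pA] := ltnP #|A v| p.
    by constructor 1; split=> //; rewrite -ltnS prednK.
  have [Bq|qB] := ltnP #|B v| q.
    by constructor 2; split=> //; rewrite -ltnS prednK.
  constructor 3; split=> //; rewrite -ltnS prednK ?addn_gt0 ?p_gt0// ltnNge.
  by apply/negP => pqAB; apply: noR; apply: rainbow_star pqAB.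
have sumV : \sum_v x v + \sum_v y v + \sum_v z v = #|V|.
  rewrite -!big_split /= -sum1_card; apply: eq_bigr => v _.
  by case: (type v) => -[-> -> ->].
exists (\sum_v x v), (\sum_v y v), (\sum_v z v); split=> //.
apply: leq_trans (total_arcs_rich (p + q)) _; rewrite leq_add2r.
(* The terms follow the types of tail and head: any to X, X to Y, Y to Y or Z, X to Z, Z to Y or Z.
   Summed, the last two merge, since [X Z + Z (Y + Z) = Z (X + Y + Z)]. *)
have pointwise u v : #|B u :&: A v| <=
    p.-1 * ((x u + y u + z u) * x v) + c * (x u * y v) +
    q.-1 * (y u * (y v + z v)) +
    (p + q).-1 * (x u * z v) + (p + q).-1 * (z u * (y v + z v)).
  have leA : #|B u :&: A v| <= #|A v| by rewrite subset_leq_card ?subsetIr.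
  have leB : #|B u :&: A v| <= #|B u| by rewrite subset_leq_card ?subsetIl.
  have lec : #|B u :&: A v| <= c by rewrite -[X in _ <= X]card_ord max_card.
  have leU w : #|A w| <= #|A w :|: B w| /\ #|B w| <= #|A w :|: B w|.
    by rewrite !subset_leq_card ?subsetUl ?subsetUr.
  have [? ?] := leU u; have [? ?] := leU v.
  by case: (type u) => -[-> -> -> ?]; case: (type v) => -[-> -> -> ?]; lia.
apply: leq_trans (_ : _ <= \sum_u \sum_v (_ + _ + _ + _ + _)) _.
  by apply: leq_sum => u _; apply: leq_sum => v _; apply: pointwise.
under eq_bigr do rewrite !big_split /= -!big_distrr /= !big_split /=.
rewrite !big_split /= -!big_distrr -?big_distrl /= ?big_split /= -sumV.
by apply: eq_leq; ring.
Qed.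
End Degrees.

(** * Extremal collections *)

Section Construction.
Variables (V : finType) (c : nat) (B A : V -> pred 'I_c).

(** Colours in [B u] may leave [u] and those in [A v] may enter [v], so the palettes of its centre
    alone can exclude a rainbow star. *)
Definition palette_arc (i : 'I_c) : rel V :=
  fun u v => [&& u != v, B u i & A v i].

Lemma palette_arc_irreflexive (i : 'I_c) : irreflexive (palette_arc i).
Proof. by move=> v; rewrite /palette_arc eqxx. Qed.

Definition palette (i : 'I_c) : digraph V :=
  Digraph (palette_arc_irreflexive i).

(** The double sum includes the diagonal, where there are no arcs; this costs at most [c] per
    vertex. *)
Lemma palette_total_arcs :
  \sum_(u : V) \sum_(v : V) #|[pred i | B u i & A v i]| <=
    total_arcs palette + c * #|V|.
Proof.
have -> : c * #|V| = \sum_(u : V) \sum_(v : V) (u == v) * c.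
  rewrite mulnC -sum_nat_const; apply: eq_bigr => u _.
  rewrite (bigD1 u)//= eqxx big1 ?addn0 ?mul1n// => v.
  by rewrite eq_sym => /negbTE ->.
rewrite total_arcs_sum -big_split; apply: leq_sum => u _.
rewrite -big_split; apply: leq_sum => v _ /=.
have [<-|uv] := eqVneq u v.
  rewrite mul1n (leq_trans (max_card _)) ?card_ord//; exact: leq_addl.
rewrite mul0n addn0 -sum1_card big_mkcond; apply: leq_sum => i _.
by rewrite /= /palette_arc uv inE; case: ifP.
Qed.

Lemma rainbow_star_colours (p q : nat) :
  contains_rainbow (star p q) palette ->
  exists v (h : 'I_p + 'I_q -> 'I_c), injective h /\
    forall s, (if s is inl _ then A v else B v) (h s).
Proof.
move=> [f [phi [_ phi_inj phiG]]].
pose e (s : 'I_p + 'I_q) : option ('I_p + 'I_q) * option ('I_p + 'I_q) :=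
  if s is inl _ then (Some s, None) else (None, Some s).
have eP s : e s \in arcs (star p q) by rewrite inE; case: s.
pose h s := phi (exist _ (e s) (eP s)).
exists (f None), h; split.
  by move=> s t /phi_inj/(congr1 sval) /=; case: s t => [a|b] [a'|b'] //= [->].
move=> s; have /and3P[] := phiG (exist _ (e s) (eP s)).
by rewrite -/(h s); case: s.
Qed.

End Construction.

Lemma injective_card_lt (T : finType) (c m : nat) (h : T -> 'I_c) :
  injective h -> (forall t, h t < m) -> #|T| <= m.
Proof.
move=> hinj hm; rewrite -[m]card_ord.
apply: (@leq_card _ _ (fun t => Ordinal (hm t))) => s t [] /ord_inj.
exact: hinj.
Qed.

Lemma card_ord_lt (c m : nat) : m <= c -> #|[pred i : 'I_c | i < m]| = m.
Proof.
move=> mc; rewrite -sum1_card (eq_bigl (fun i : 'I_c => i < m))//.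
by rewrite -(big_ord_widen c (fun=> 1) mc) sum1_card card_ord.
Qed.

Lemma low_construction (n p q c : nat) : 0 < p -> p + q <= c ->
  exists G : 'I_c -> digraph 'I_n, ~ contains_rainbow (star p q) G /\
    (p + q).-1 * n * n <= total_arcs G + c * n.
Proof.
move=> p_gt0 pqc; pose A (_ : 'I_n) (i : 'I_c) := i < (p + q).-1.
exists (palette A A); split.
  move=> /rainbow_star_colours[v [h [hinj hA]]].
  have := injective_card_lt hinj (m := (p + q).-1).
  rewrite card_sum !card_ord => /(_ _)/wrap[s|]; last by lia.
  by have := hA s; case: s.
have := palette_total_arcs A A; rewrite card_ord; apply: leq_trans.
rewrite (eq_bigr (fun=> (p + q).-1 * n)) => [|u _].
  by rewrite sum_nat_const card_ord mulnC.
rewrite (eq_bigr (fun=> (p + q).-1)) ?sum_nat_const ?card_ord 1?mulnC// => v _.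
rewrite -[RHS](@card_ord_lt c); last by lia.
by apply: eq_card => i; rewrite !inE andbb.
Qed.

(** A centre below [Y] has only [q - 1] colours for its out-arcs, any other centre only [p - 1] for
    its in-arcs. *)
Lemma high_construction (n p q c Y : nat) : 0 < p -> p <= q -> p + q <= c ->
  Y <= n ->
  exists G : 'I_c -> digraph 'I_n, ~ contains_rainbow (star p q) G /\
    p.-1 * n * (n - Y) + c * (n - Y) * Y + q.-1 * Y * Y <= total_arcs G + c * n.
Proof.
move=> p_gt0 pq pqc Yn.
pose B (v : 'I_n) (i : 'I_c) := (Y <= v) || (i < q.-1).
pose A (v : 'I_n) (i : 'I_c) := (v < Y) || (i < p.-1).
exists (palette B A); split.
  move=> /rainbow_star_colours[v [h [hinj hAB]]].
  have [vY|Yv] := ltnP v Y.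
    have := @injective_card_lt _ c q.-1 (h \o inr)
      (inj_comp hinj (@inr_inj _ _)).
    rewrite card_ord => /(_ _)/wrap[b|]; last by lia.
    by have := hAB (inr b); rewrite /B leqNgt vY.
  have := @injective_card_lt _ c p.-1 (h \o inl) (inj_comp hinj (@inl_inj _ _)).
  rewrite card_ord => /(_ _)/wrap[a|]; last by lia.
  by have := hAB (inl a); rewrite /A ltnNge Yv.
have := palette_total_arcs B A; rewrite card_ord; apply: leq_trans.
pose x (v : 'I_n) : nat := Y <= v; pose y (v : 'I_n) : nat := v < Y.
have sumy : \sum_v y v = Y.
  rewrite /y -[RHS](card_ord_lt Yn) -sum1_card [RHS]big_mkcond /=.
  by apply: eq_bigr => v _; rewrite inE; case: ltnP.
have sumx : \sum_v x v = n - Y.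
  apply: (@addIn Y); rewrite subnK// -[in LHS]sumy -big_split /= -[RHS]card_ord.
  by rewrite -sum1_card; apply: eq_bigr => v _; rewrite /x /y; case: ltnP.
have pointwise u v : p.-1 * x v + c * (x u * y v) + q.-1 * (y u * y v) <=
    #|[pred i | B u i & A v i]|.
  have mono m : m <= c -> (forall i : 'I_c, i < m -> B u i && A v i) ->
      m <= #|[pred i | B u i & A v i]|.
    move=> mc mBA; rewrite -[X in X <= _](card_ord_lt mc).
    by apply: subset_leq_card; apply/subsetP => i; rewrite !inE; apply: mBA.
  (* For a head [v >= Y] the first [p - 1] colours are available from every tail; for a tail below
     [Y] this uses [p <= q]. *)
  rewrite /x /y; have [vY|Yv] := ltnP v Y; last first.
    rewrite !muln0 !muln1 !addn0; apply: mono => [|i ip]; first by lia.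
    by rewrite /A /B ip (leq_trans ip) ?orbT//; lia.
  have [uY|Yu] := ltnP u Y; rewrite !muln0 !muln1 ?add0n ?addn0.
    by apply: mono => [|i ip]; [lia|rewrite /A /B vY ip orbT].
  by apply: mono => // i _; rewrite /A /B vY Yu.
apply: leq_trans (_ : _ <= \sum_u \sum_v (_ + _ + _)) _; last first.
  by apply: leq_sum => u _; apply: leq_sum => v _; apply: pointwise.
under eq_bigr do rewrite !big_split /= -!big_distrr /=.
rewrite !big_split /= -!big_distrr -?big_distrl /= sum_nat_const card_ord.
by rewrite sumx sumy; apply: eq_leq; ring.
Qed.

(* Quadratic inequalities over the reals *)
Local Close Scope set_scope.
Local Open Scope classical_set_scope.
Local Open Scope ring_scope.

Lemma linear_littleo_square (R : realType) (K : R) :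
  (fun n : nat => K * n%:R) =o_\oo (fun n : nat => n%:R ^+ 2 : R).
Proof.
apply/eqoP => e e_gt0; near=> n.
have n_gt0 : 0 < n%:R :> R by rewrite ltr0n; near: n; exists 1%N.
rewrite normrM normrX (ger0_norm (ler0n _ _)).
rewrite expr2 mulrA ler_pM2r// mulrC -ler_pdivrMr//.
by near: n; apply: nbhs_infty_ger.
Unshelve. all: by end_near. Qed.

(** By AM-GM, [q x^2 + p y^2 >= 2 w x y], so [(q x + p y) (x + y) >= (p + q + 2 w) x y]; the terms
    with [z] only enlarge the right side. *)
Lemma low_form (R : realType) (p q d w x y z : R) :
  0 < q -> 0 <= p -> 0 <= w -> w ^+ 2 = p * q -> d <= p + q + 2 * w ->
  0 <= x -> 0 <= y -> 0 <= z ->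
  d * x * y <= (q * x + p * y) * (x + y + z).
Proof.
move=> q0 p0 w0 w2 dle x0 y0 z0.
have xy0 : 0 <= x * y by apply: mulr_ge0.
have h1 : d * (x * y) <= (p + q + 2 * w) * (x * y) by apply: ler_wpM2r.
have h2 : 0 <= (q * x + p * y) * z.
  by rewrite mulr_ge0// addr_ge0// mulr_ge0// ltW.
have h3 : 0 <= q * x ^+ 2 + p * y ^+ 2 - 2 * w * (x * y).
  rewrite -(pmulr_rge0 _ q0).
  have -> : q * (q * x ^+ 2 + p * y ^+ 2 - 2 * w * (x * y)) =
      (q * x - w * y) ^+ 2.
    by rewrite sqrrB exprMn exprMn w2; ring.
  exact: sqr_ge0.
lra.
Qed.

(* With every factor x + y + z lowered to x + y, the two sides differ by the
   square of 2 d y - (d + q - p) (x + y). *)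
Lemma high_form (R : realType) (p q d x y z : R) :
  0 <= q -> 0 <= p -> 0 <= d -> 4 * q * d <= (d + q - p) ^+ 2 ->
  0 <= x -> 0 <= y -> 0 <= z ->
  4 * d * (d * x * y - (q * x + p * y) * (x + y + z)) <=
    ((d + q - p) ^+ 2 - 4 * q * d) * (x + y + z) ^+ 2.
Proof.
move=> q0 p0 d0 dqp x0 y0 z0.
set m := (d + q - p) ^+ 2 - 4 * q * d.
have m0 : 0 <= m by rewrite subr_ge0.
have h1 : m * (x + y) ^+ 2 <= m * (x + y + z) ^+ 2.
  by rewrite ler_wpM2l// lerXn2r ?nnegrE ?addr_ge0// lerDl.
have h2 : 0 <= 4 * d * ((q * x + p * y) * z).
  by rewrite !mulr_ge0// addr_ge0// mulr_ge0.
have h3 : 0 <= (2 * d * y - (d + q - p) * (x + y)) ^+ 2 by apply: sqr_ge0.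
have h4 : m * (x + y) ^+ 2 - 4 * d * (d * x * y - (q * x + p * y) * (x + y)) =
  (2 * d * y - (d + q - p) * (x + y)) ^+ 2 by rewrite /m; ring.
rewrite -h4 in h3; apply: le_trans h1.
move: h2 h3; rewrite [(_ + _) * (x + y + z)]mulrDr.
move: ((q * x + p * y) * z) => t; move: (_ * (x + y)) => s; lra.
Qed.

(** * Comparison of the two main terms *)

Section Densities.
Variables (R : realType) (p q c : nat).
Hypotheses (p_gt0 : (0 < p)%N) (pq : (p <= q)%N) (pqc : (p + q <= c)%N).

Let d : R := c%:R - q%:R + 1.
Let w : R := Num.sqrt (p%:R * q%:R).

Let p1 : 1 <= p%:R :> R. Proof. by rewrite ler1n. Qed.
Let pqR : p%:R <= q%:R :> R. Proof. by rewrite ler_nat. Qed.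
Let cR : p%:R + q%:R <= c%:R :> R. Proof. by rewrite -natrD ler_nat. Qed.
Let d_gt0 : 0 < d. Proof. by rewrite /d; have := p1; have := cR; lra. Qed.
Let w0 : 0 <= w. Proof. exact: sqrtr_ge0. Qed.
Let w2 : w ^+ 2 = p%:R * q%:R.
Proof. by rewrite sqr_sqrtr// mulr_ge0. Qed.

(** In terms of [d] the threshold is [p + q + 2 w], the square of [sqrt p + sqrt q], as in
    [low_form]. *)
Lemma threshold_le : (c%:R <= threshold R p q) = (d <= p%:R + q%:R + 2 * w).
Proof. by rewrite /threshold -/w /d; apply/idP/idP => h; lra. Qed.

Lemma threshold_ge : (threshold R p q <= c%:R) = (p%:R + q%:R + 2 * w <= d).
Proof. by rewrite /threshold -/w /d; apply/idP/idP => h; lra. Qed.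

Lemma high_densityE :
  4 * d * (high_density R p q c - p%:R + 1) = (d + q%:R - p%:R) ^+ 2.
Proof.
have d_neq0 : d != 0 by rewrite gt_eqF.
have cE : c%:R = d + q%:R - 1 by rewrite /d; ring.
rewrite /high_density -/d [in LHS]cE.
by move: (d) d_neq0 => e e_neq0; field.
Qed.

(** The left side is [(d + q - p)^2 - 4 q d = (d - p - q)^2 - 4 p q]. The threshold is the larger
    root in [d]. *)
Lemma high_low : 4 * d * (high_density R p q c - low_density R p q) =
  (d - p%:R - q%:R - 2 * w) * (d - p%:R - q%:R + 2 * w).
Proof.
rewrite -subr_sqr exprMn w2 /low_density.
rewrite (_ : high_density R p q c - (p%:R + q%:R - 1) =
  (high_density R p q c - p%:R + 1) - q%:R); last by ring.
by rewrite mulrBr high_densityE; ring.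
Qed.

Lemma low_le_high : threshold R p q <= c%:R ->
  low_density R p q <= high_density R p q c.
Proof.
rewrite threshold_ge => h.
rewrite -subr_ge0 -(@pmulr_rge0 _ (4 * d)) ?mulr_gt0//.
by rewrite high_low mulr_ge0//; move: w0; lra.
Qed.

(** At the threshold a single collection must meet both lower bounds, so the two main terms have to
    agree; a factor in [high_low] vanishes there. *)
Lemma high_eq_low : c%:R <= threshold R p q -> threshold R p q <= c%:R ->
  high_density R p q c = low_density R p q.
Proof.
rewrite threshold_le threshold_ge => h1 h2.
apply/eqP; rewrite -subr_eq0; have := high_low.
rewrite (_ : d - p%:R - q%:R - 2 * w = 0) ?mul0r; last by lra.
by move=> /eqP; rewrite !mulf_eq0 pnatr_eq0 /= gt_eqF.
Qed.

Lemma types_density (X Y Z : nat) (N := (X + Y + Z)%N) :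
  let T : R := (p.-1 * X * N + c * (X * Y) + q.-1 * Y * (Y + Z) +
    (p + q).-1 * Z * N)%N%:R in
  (c%:R <= threshold R p q -> T <= low_density R p q * N%:R ^+ 2) /\
  (threshold R p q <= c%:R -> T <= high_density R p q c * N%:R ^+ 2).
Proof.
move=> T; set x : R := X%:R; set y : R := Y%:R; set z : R := Z%:R.
have predR m : (0 < m)%N -> m.-1%:R = m%:R - 1 :> R.
  by move=> m_gt0; rewrite -subn1 natrB.
have NE : N%:R = x + y + z :> R by rewrite !natrD.
(* Taking all vertices of type Z gives the low density; the remaining form is what [low_form] and
   [high_form] bound. *)
have TE : T = d * x * y - (q%:R * x + p%:R * y) * (x + y + z) +
    low_density R p q * (x + y + z) ^+ 2.
  rewrite /T !(natrD, natrM) !predR ?addn_gt0 ?p_gt0// ?(leq_trans p_gt0)//.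
  by rewrite natrD -/x -/y -/z /d /low_density; ring.
have [x0 y0 z0] : [/\ 0 <= x, 0 <= y & 0 <= z] by split; apply: ler0n.
split=> h; rewrite TE NE.
  rewrite gerDr subr_le0; rewrite threshold_le in h.
  by apply: low_form h x0 y0 z0 => //; rewrite ltr0n (leq_trans p_gt0).
rewrite -lerBrDr -mulrBl -(@ler_pM2l _ (4 * d)) ?mulr_gt0// [leRHS]mulrA.
rewrite (_ : 4 * d * (high_density R p q c - low_density R p q) =
    (d + q%:R - p%:R) ^+ 2 - 4 * q%:R * d); last first.
  by rewrite -high_densityE /low_density; ring.
apply: high_form => //; [exact: ltW|].
(* The condition [4 q d <= (d + q - p)^2] is [low_le_high] multiplied by [4 d]. *)
rewrite -subr_ge0 -high_densityE.
have := low_le_high h; rewrite -subr_ge0 -(@pmulr_rge0 _ (4 * d)) ?mulr_gt0//.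
by rewrite /low_density; lra.
Qed.

Lemma high_split (n : nat) : (0 < n)%N -> threshold R p q <= c%:R ->
  exists2 Y : nat, (Y <= n)%N &
    high_density R p q c * n%:R ^+ 2 - (c%:R + 1) * n%:R <=
    (p.-1 * n * (n - Y) + c * (n - Y) * Y + q.-1 * Y * Y)%N%:R.
Proof.
move=> n_gt0; rewrite threshold_ge => h.
(* The real maximiser of the count is [Y = t n]; [Y] is taken as its integer part. *)
pose t : R := (d + q%:R - p%:R) / (2 * d).
have tE : 2 * d * t = d + q%:R - p%:R by rewrite mulrC divfK// gt_eqF ?mulr_gt0.
have t0 : 0 <= t by rewrite divr_ge0 ?mulr_ge0 ?ltW//; move: d_gt0 pqR; lra.
have t1 : t <= 1 by rewrite ler_pdivrMr ?mulr_gt0//; move: w0 p1 h; lra.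
have n0 : 0 <= n%:R :> R by [].
have /andP[Yt tY] := truncn_itv (mulr_ge0 t0 n0).
move: (Num.truncn _) Yt tY => Y Yt tY.
have Yn : (Y <= n)%N.
  by rewrite -(ler_nat R) (le_trans Yt)// ler_piMl.
have predR m : (0 < m)%N -> m.-1%:R = m%:R - 1 :> R.
  by move=> m_gt0; rewrite -subn1 natrB.
exists Y => //; rewrite !(natrD, natrM) natrB// !predR ?(leq_trans p_gt0)//.
set N : R := n%:R; set y : R := Y%:R.
have highE : high_density R p q c = d * t ^+ 2 + p%:R - 1.
  apply: (@mulfI _ (4 * d)); first by rewrite gt_eqF ?mulr_gt0.
  have := high_densityE; rewrite -tE => hE.
  rewrite (_ : 4 * d * (d * t ^+ 2 + p%:R - 1) =
    (2 * d * t) ^+ 2 + 4 * d * (p%:R - 1)); last by ring.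
  by rewrite -hE; ring.
(* Completing the square: rounding costs exactly [d (t N - y)^2], which is at most [d <= c + 1]. *)
have -> : (p%:R - 1) * N * (N - y) + c%:R * (N - y) * y + (q%:R - 1) * y * y =
    high_density R p q c * N ^+ 2 - d * (t * N - y) ^+ 2.
  rewrite highE.
  rewrite (_ : c%:R = 2 * d * t + p%:R - 1); last by rewrite tE /d; ring.
  rewrite [in RHS](_ : d * (t * N - y) ^+ 2 =
    d * t ^+ 2 * N ^+ 2 - 2 * d * t * N * y + d * y ^+ 2); last by ring.
  rewrite tE /d; ring.
rewrite lerD2l lerN2.
have N1 : 1 <= N by rewrite ler1n.
have dc : d <= c%:R + 1 by rewrite /d; move: pqR p1; lra.
apply: ler_pM => //; [exact: ltW|exact: sqr_ge0|].
rewrite (le_trans _ N1)// expr_le1// ?subr_ge0//.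
by move: tY; rewrite -natr1 -/y; lra.
Qed.

End Densities.

Theorem theorem3 (R : realType) (p q c : nat)
    (hp : (1 <= p)%N) (hpq : (p <= q)%N) (hc : (p + q <= c)%N) :
  (exists eps : nat -> R,
      eps =o_\oo (fun n : nat => n%:R ^+ 2 : R) /\
      forall (n : nat), (0 < n)%N ->
      forall (V : finType), #|V| = n ->
      forall G : 'I_c -> digraph V, ~ contains_rainbow (star p q) G ->
        (c%:R <= threshold R p q ->
           (total_arcs G)%:R <= low_density R p q * n%:R ^+ 2 + eps n) /\
        (threshold R p q <= c%:R ->
           (total_arcs G)%:R <= high_density R p q c * n%:R ^+ 2 + eps n)) /\
  (exists delta : nat -> R,
      delta =o_\oo (fun n : nat => n%:R ^+ 2 : R) /\
      forall (n : nat), (0 < n)%N ->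
      exists G : 'I_c -> digraph 'I_n,
        ~ contains_rainbow (star p q) G /\
        (c%:R <= threshold R p q ->
           low_density R p q * n%:R ^+ 2 - delta n <= (total_arcs G)%:R) /\
        (threshold R p q <= c%:R ->
           high_density R p q c * n%:R ^+ 2 - delta n <= (total_arcs G)%:R)).
Proof.
split.
  (* The error is the contribution of the poor colours. *)
  exists (fun n => (2 * c * (p + q))%:R * n%:R); split.
    exact: linear_littleo_square.
  move=> n n_gt0 V cV G noR.
  have [X [Y [Z [XYZ le]]]] := total_arcs_types hp hpq noR.
  have [low high] := types_density R hp hpq hc X Y Z.
  rewrite -cV -XYZ in le *.
  have {}le := le; rewrite -(ler_nat R) natrD [X in _ + X]natrM in le.
  by split=> h; apply: le_trans le _; rewrite lerD2r; [apply: low|apply: high].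
(* One [c n] pays for the missing loops, [(c + 1) n] for rounding [Y]. *)
exists (fun n => (c%:R + (c%:R + 1)) * n%:R); split.
  exact: linear_littleo_square.
move=> n n_gt0.
have [cle|cgt] := leP c%:R (threshold R p q).
  have [G [noR le]] := low_construction n hp hc.
  exists G; split=> //.
  have low : low_density R p q * n%:R ^+ 2 - (c%:R + (c%:R + 1)) * n%:R <=
      (total_arcs G)%:R.
    move: le; rewrite -(ler_nat R) natrD !natrM -subn1 natrB ?addn_gt0 ?hp//.
    rewrite natrD /low_density => le.
    have : 0 <= (c%:R + 1) * n%:R :> R by rewrite mulr_ge0// addr_ge0.
    by move: le; lra.
  by split=> // cge; rewrite (high_eq_low hp hc cle cge).
have [Y Yn high] := high_split hp hpq hc n_gt0 (ltW cgt).
have [G [noR le]] := high_construction hp hpq hc Yn.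
exists G; split=> //; split=> // _.
move: le; rewrite -(ler_nat R) natrD [X in _ + X]natrM => le.
by move: high le; lra.
Qed.
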